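(* Let $G$ be a finite group, let $T$ be a set of representatives of the conjugacy classes of subgroups of prime order in $G$ (exactly one subgroup from each class), and let $T=A\amalg B$ be a partition of $T$ into two disjoint subsets $A$ and $B$. Then there exists a unital commutative ring $R=R_{A,B}$ on which $G$ acts by ring automorphisms such that for every $P\in A$ there is an element $x_P\in R$ with $tr_P(x_P)=1$, and for every $P\in B$ there exists no element $x_P\in R$ with $tr_P(x_P)=1$.
   Context: For a subgroup $H$ of $G$, the trace map $tr_H:R\to R$ is defined by $tr_H(x)=\sum_{\sigma\in H}\sigma(x)$. *)

(* Defs.v *)
From HB Require Import structures.
From mathcomp Require Import all_boot all_algebra all_fingroup.

Set Implicit Arguments.
Unset Strict Implicit.
Unset Printing Implicit Defensive.

Import GroupScope GRing.Theory.

Definition prime_subgroups (gT : finGroupType) (G : {group gT}) :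
    {set {group gT}} :=
  [set P : {group gT} | (P \subset G) && prime #|P|].

(* 'JG is conjugation of subgroups, so the blocks of the partition are the
   G-conjugacy classes of subgroups of prime order; T meets each exactly once. *)
Definition prime_subgroup_representatives (gT : finGroupType) (G : {group gT})
    (T : {set {group gT}}) : bool :=
  is_transversal T (orbit 'JG G @: prime_subgroups G) (prime_subgroups G).

(* MathComp actions are right actions: sigma(x) is [to x s], with
   [to x (s * t) = to (to x s) t]. Composing with s |-> s^-1 gives a left
   action with the same traces over subgroups. The maps [to^~ s] are bijective
   because [to] is an action, so these morphisms are automorphisms. *)
Definition acts_by_ring_automorphisms (gT : finGroupType) (G : {group gT})
    (R : comNzRingType) (to : action G R) : Prop :=
  forall s, s \in G ->
    GRing.zmod_morphism (to^~ s) /\ GRing.monoid_morphism (to^~ s).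

Definition act_trace (gT : finGroupType) (G : {group gT}) (R : comNzRingType)
    (to : action G R) (H : {group gT}) (x : R) : R :=
  (\sum_(s in H) to x s)%R.

(* Main.v *)
Require Import Defs.
From HB Require Import structures.
From mathcomp Require Import all_boot all_algebra all_fingroup.

Set Implicit Arguments.
Unset Strict Implicit.
Unset Printing Implicit Defensive.

Import GroupScope GRing.Theory.

(** A trace over P hits 1 in a product of G-rings if and only if it does so in
    each factor. It is therefore enough to find, for one subgroup Q of prime
    order q, a G-ring in which 1 is a P-trace exactly for the prime order
    subgroups P of G that are not conjugate to Q ([coset_ring]); the product of
    these rings over all Q in B then works, because P in A and Q in B are
    distinct representatives, hence not conjugate.

    The ring for Q is the ring of functions from the G-set of cosets of Q to
    the field with q elements. For functions from any finite G-set X to a field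
    F, the P-trace of f takes at x the sum of the values of f on the P-orbit of x,
    multiplied by the order of the stabiliser of x in P. Hence 1 is a P-trace if and
    only if all these stabilisers have an order that is invertible in F
    ([function_traceP]). The stabilisers of the cosets of Q are the intersections
    of P with the conjugates of Q, and q divides the order of such an
    intersection exactly when P equals that conjugate. *)

(** * Rings of functions on a finite G-set *)

Section FunctionRing.

Variables (X : finType) (x0 : X) (F : fieldType).

(** The index [x] witnesses that X is nonempty, without which the ring of
    functions on X would be trivial. *)
Definition function_ring (x : X) := {ffun X -> F}.

HB.instance Definition _ := GRing.PzRing.on (function_ring x0).
HB.instance Definition _ :=
  GRing.PzSemiRing_isNonZero.Build (function_ring x0)
    (@ssralg.ffun1_nonzero X F x0).
HB.instance Definition _ :=
  GRing.PzRing_hasCommutativeMul.Build (function_ring x0)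
    (@ssralg.ffun_mulC X F).

Variables (gT : finGroupType) (G : {group gT}) (to : action G X).

Definition translate (f : function_ring x0) (s : gT) : function_ring x0 :=
  [ffun x => f (to x s^-1)].

Lemma translate_is_action : is_action G translate.
Proof.
split=> [s f g /ffunP Efg | f s t Gs Gt].
  apply/ffunP=> x; have:= Efg (invF (act_inj to s^-1) x).
  by have /= Ex := f_invF (act_inj to s^-1) x; rewrite !ffunE Ex.
by apply/ffunP=> x; rewrite !ffunE invMg actMin ?groupV.
Qed.

Definition function_action : action G (function_ring x0) :=
  Action translate_is_action.

Lemma function_action_automorphisms :
  acts_by_ring_automorphisms function_action.
Proof.
by move=> s _; split; [|split]; do ?[move=> f g]; apply/ffunP=> x;
  rewrite !ffunE.
Qed.

(** Each point of the orbit is reached by one coset of the stabiliser. *)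
Lemma sum_act_orbit (P : {group gT}) (f : X -> F) x :
  P \subset G ->
  (\sum_(s in P) f (to x s)
    = (\sum_(y in orbit to P x) f y) *+ #|'C_P[x | to]|)%R.
Proof.
move=> sPG; rewrite (partition_big (to x) [in orbit to P x]) /=; last first.
  by move=> s Ps; apply: mem_orbit.
rewrite -GRing.sumrMnl; apply: eq_bigr => _ /imsetP[a Pa ->].
rewrite (eq_bigr (fun=> f (to x a))); last by move=> s /andP[_ /eqP->].
rewrite sumr_const -(card_rcoset 'C_P[x | to] a) -amove_act //.
by congr (_ *+ _)%R; apply: eq_card => s; rewrite !inE.
Qed.

Lemma function_traceE (P : {group gT}) (f : function_ring x0) x :
  P \subset G ->
  (act_trace function_action P f) x
    = ((\sum_(y in orbit to P x) f y) *+ #|'C_P[x | to]|)%R.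
Proof.
move=> sPG; rewrite -sum_act_orbit // /act_trace.
rewrite [LHS]ssralg.sum_ffunE (reindex_inj invg_inj) /=.
by apply: eq_big => s; rewrite ?groupV // ffunE invgK.
Qed.

(** By [function_traceE], a value of a trace at x is a multiple of the order of
    the stabiliser of x. Conversely, if these orders are invertible, then a
    function of trace 1 is obtained by choosing one point in each P-orbit and
    putting the inverse of the order of its stabiliser there. *)
Lemma function_traceP (P : {group gT}) :
  P \subset G ->
  (exists f, act_trace function_action P f = 1%R) <->
  (forall x, #|'C_P[x | to]|%:R != 0 :> F)%R.
Proof.
move=> sPG; split=> [[f trf] x | nzC].
  apply/eqP=> C0; have := oner_neq0 F.
  rewrite -[X in X != _](ffunE (fun=> 1%R) x).
  rewrite -[[ffun _ => _]]/(1%R : function_ring x0) -trf function_traceE //.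
  by rewrite -mulr_natl C0 mul0r eqxx.
have actsP : [acts P, on setT | to].
  apply/subsetP=> s Ps; rewrite !inE (subsetP sPG) //.
  by apply/subsetP=> x; rewrite !inE.
pose Y := orbit_transversal to P setT.
have [_ _ uniqY orbitY] := orbit_transversalP actsP.
exists [ffun y => if y \in Y then (#|'C_P[y | to]|%:R)^-1 else 0]%R.
apply/ffunP=> x; rewrite function_traceE // [RHS]ffunE.
have [a Pa Yxa] := orbitY x (in_setT x).
have xPxa : to x a \in orbit to P x by apply: mem_orbit.
have sameC : #|'C_P[to x a | to]| = #|'C_P[x | to]|.
  apply/eqP; rewrite -(@eqn_pmul2l #|orbit to P x|).
    by rewrite -{1}(orbit_in_eqP sPG xPxa) !card_orbit_in_stab.
  by apply/card_gt0P; exists (to x a).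
rewrite (bigD1 (to x a)) //= ffunE Yxa sameC big1 => [|y /andP[xPy neq_y]].
  by rewrite addr0 -[LHS]mulr_natr mulVf.
rewrite ffunE; case: ifP => // Yy; case/negP: neq_y.
by rewrite eq_sym -uniqY // (orbit_in_eqP sPG xPxa).
Qed.

End FunctionRing.

(** * Products of G-rings *)

Lemma product_ring (gT : finGroupType) (G : {group gT}) (R1 R2 : comNzRingType)
    (to1 : action G R1) (to2 : action G R2) :
  acts_by_ring_automorphisms to1 -> acts_by_ring_automorphisms to2 ->
  exists to : action G (R1 * R2)%type, acts_by_ring_automorphisms to /\
    forall P : {group gT},
      (exists x, act_trace to P x = 1%R) <->
      (exists x, act_trace to1 P x = 1%R) /\
      (exists x, act_trace to2 P x = 1%R).
Proof.
move=> aut1 aut2.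
have [inj1 mul_to1] : is_action G to1 by case: (to1).
have [inj2 mul_to2] : is_action G to2 by case: (to2).
pose f (x : R1 * R2) s := (to1 x.1 s, to2 x.2 s).
have act_f : is_action G f.
  split=> [s [x1 x2] [y1 y2] [Exy1 Exy2] | [x1 x2] s t Gs Gt].
    by congr (_, _); [apply: inj1 Exy1 | apply: inj2 Exy2].
  by rewrite /f /= mul_to1 ?mul_to2.
exists (Action act_f); split=> [s Gs | P].
  have [add1 [one1 mul1]] := aut1 s Gs; have [add2 [one2 mul2]] := aut2 s Gs.
  split; [move=> x y | split=> [|x y]]; rewrite /= /f /=.
  - by rewrite add1 add2.
  - by rewrite one1 one2.
  - by rewrite mul1 mul2.
have trE x : act_trace (Action act_f) P x =
    (act_trace to1 P x.1, act_trace to2 P x.2).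
  apply/eqP; rewrite -pair_eqE /pair_eq /= /act_trace.
  by rewrite !(raddf_sum fst) !(raddf_sum snd) !eqxx.
split=> [[x] | [[x1 tr1] [x2 tr2]]].
  by rewrite trE => -[tr1 tr2]; split; [exists x.1 | exists x.2].
by exists (x1, x2); rewrite trE /= tr1 tr2.
Qed.

(** * The G-ring that excludes the conjugates of one or several subgroups *)

Lemma astab1_rcoset (gT : finGroupType) (Q : {group gT}) g :
  'C[Q :* g | 'Rs] = Q :^ g.
Proof. by rewrite -rcosetE -[rcoset Q g]/('Rs%act Q g) astab1_act astab1Rs. Qed.

(** For functions from the cosets of Q to the field with [#|Q|] elements: a
    subgroup P of prime order either acts freely on the cosets, or fixes some
    coset [Q :* g] and then equals [Q :^ g], so that its order is zero in the
    field. *)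
Lemma coset_ring (gT : finGroupType) (G Q : {group gT}) :
  Q \subset G -> prime #|Q| ->
  exists (R : comNzRingType) (to : action G R), acts_by_ring_automorphisms to /\
    forall P : {group gT}, P \subset G -> prime #|P| ->
      (exists x, act_trace to P x = 1%R) <-> P \notin orbit 'JG G Q.
Proof.
move=> sQG prQ.
have Q_coset : (Q : {set gT}) \in rcosets Q G by apply: (orbit_refl 'Rs%act).
pose X := {C : {set gT} | C \in rcosets Q G}.
pose x0 : X := exist _ (Q : {set gT}) Q_coset.
have sGdom : G \subset subact_dom (fun C => C \in rcosets Q G) 'Rs.
  rewrite /subact_dom (_ : finset _ = rcosets Q G) ?actsRs_rcosets //.
  by apply/setP=> C; rewrite inE.
pose to : action G X := ('Rs^? \ sGdom)%act.
exists (function_ring 'F_#|Q| x0), (function_action x0 'F_#|Q| to).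
split=> [|P sPG prP]; first exact: function_action_automorphisms.
have stabX x : 'C_P[x | to] = P :&: 'C[val x | 'Rs].
  rewrite astab_ract astab_subact imset_set1.
  by rewrite setIA (setIidPl sGdom) setIA (setIidPl sPG).
apply: iff_trans (function_traceP x0 'F_#|Q| to sPG) _.
split=> [nzC | /orbitP not_conj x].
  apply/orbitP=> -[g Gg defP].
  have Qg_coset : Q :* g \in rcosets Q G by apply/rcosetsP; exists g.
  pose x : X := exist _ (Q :* g) Qg_coset.
  have /negP[] := nzC x.
  rewrite -(dvdn_pcharf (pchar_Fp prQ)) stabX /=.
  by rewrite astab1_rcoset -defP setIid /= cardJg.
have /rcosetsP[g Gg def_x] := valP x.
rewrite -(dvdn_pcharf (pchar_Fp prQ)) stabX def_x astab1_rcoset.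
(* Divisibility by the order of Q forces the conjugate of Q to lie in P, and a
   subgroup of prime order has no proper nontrivial subgroup. *)
apply/negP=> dvQ; case: not_conj; exists g => //.
apply/val_inj/esym/eqP=> /=.
have sQgP : Q :^ g \subset P.
  apply/setIidPr/eqP; rewrite eqEcard subsetIr cardJg.
  by rewrite dvdn_leq // (cardG_gt0 (P :&: Q :^ g)).
have := cardSg sQgP; rewrite cardJg dvdn_prime2 // => /eqP eqQP.
by rewrite eq_sym eqEcard sQgP cardJg eqQP /=.
Qed.

(** The empty product is replaced by the rational numbers with the trivial
    action, where all traces over subgroups hit 1. They appear as functions on a
    point, so that [function_traceP] applies. *)
Lemma nonconjugate_trace_ring (gT : finGroupType) (G : {group gT})
    (B : seq {group gT}) :
  {in B, forall Q : {group gT}, Q \subset G /\ prime #|Q|} ->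
  exists (R : comNzRingType) (to : action G R), acts_by_ring_automorphisms to /\
    forall P : {group gT}, P \subset G -> prime #|P| ->
      (exists x, act_trace to P x = 1%R) <->
      {in B, forall Q, P \notin orbit 'JG G Q}.
Proof.
elim: B => [_ | Q B IHB prB].
  have trivial_act : is_action G (fun (x : unit) (_ : gT) => x).
    by split=> // s x y.
  exists (function_ring rat tt), (function_action tt rat (Action trivial_act)).
  split=> [|P sPG _]; first exact: function_action_automorphisms.
  apply: iff_trans (function_traceP _ _ _ sPG) _; split=> // _ x.
  by rewrite Num.Theory.pnatr_eq0 -lt0n cardG_gt0.
have [sQG prQ] := prB Q (mem_head Q B).
have [R1 [to1 [aut1 tr1]]] := coset_ring sQG prQ.
have [Q0 BQ0 | R2 [to2 [aut2 tr2]]] := IHB.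
  by apply: prB; rewrite inE BQ0 orbT.
have [to [aut tr]] := product_ring aut1 aut2.
exists (R1 * R2)%type, to; split=> // P sPG prP.
apply: iff_trans (tr P) _; split=> [[/tr1 nQ /tr2 nB] Q0 | nB].
  by rewrite inE => /predU1P[-> | BQ0]; [apply: nQ | apply: nB].
by split; [apply/tr1 | apply/tr2] => // [|Q0 BQ0]; apply: nB;
  rewrite inE ?eqxx ?BQ0 ?orbT.
Qed.

Theorem proposition1p2 (gT : finGroupType) (G : {group gT})
    (T A B : {set {group gT}})
    (hT : prime_subgroup_representatives G T)
    (hAB : T = A :|: B) (hdisj : [disjoint A & B]) :
  exists (R : comNzRingType) (to : action G R),
    [/\ acts_by_ring_automorphisms to,
        forall P : {group gT}, P \in A ->
          exists x : R, act_trace to P x = 1%R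
      & forall P : {group gT}, P \in B ->
          ~ exists x : R, act_trace to P x = 1%R].
Proof.
have primeT P : P \in T -> P \subset G /\ prime #|P|.
  by move/(subsetP (transversal_sub hT)); rewrite inE => /andP.
have AT P : P \in A -> P \in T by rewrite hAB inE => ->.
have BT P : P \in B -> P \in T by rewrite hAB inE orbC => ->.
have [Q | R [to [aut tr]]] := @nonconjugate_trace_ring gT G (enum B).
  by rewrite mem_enum => /BT/primeT.
exists R, to; split=> // P.
  move=> PA; have [sPG prP] := primeT P (AT P PA).
  apply/tr=> // Q; rewrite mem_enum => QB; apply/negP=> PQ.
  have blockT S : S \in T ->
      pblock (orbit 'JG G @: prime_subgroups G) S = orbit 'JG G S.
    move=> ST; apply: def_pblock; last exact: orbit_refl.
      by case/andP: hT => /and3P[].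
    by apply/imset_f/(subsetP (transversal_sub hT)).
  have eqPQ : P = Q.
    apply: (pblock_inj hT (AT P PA) (BT Q QB)).
    by rewrite !blockT ?(AT P PA) ?(BT Q QB) //; apply/orbit_eqP.
  by have := disjointFr hdisj PA; rewrite eqPQ QB.
move=> PB /tr; have [sPG prP] := primeT P (BT P PB).
by move/(_ sPG prP P); rewrite mem_enum PB orbit_refl => /(_ isT).
Qed.
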